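(* Let $(A,\nwarrow,\nearrow,\swarrow,\searrow)$ be a quadri-algebra with associated vertical dendriform algebra $A_v=(A,\wedge,\vee)$, and for $\lambda_1,\lambda_2,\lambda_3,\lambda_4\in\mathbb F$ let $$N_{\lambda_1,\lambda_2,\lambda_3,\lambda_4}((x,y)):=(\lambda_1y+\lambda_2x,\ \lambda_3x+\lambda_4y),\qquad x,y\in A.$$ Then $N_{\lambda_1,\lambda_2,\lambda_3,\lambda_4}$ is a Nijenhuis operator on $A_v\ltimes_{L_\nearrow,R_\nwarrow,L_\searrow,R_\swarrow}A$. Moreover, if $(A_v,A_v,L_\nearrow,R_\nwarrow,L_\searrow,R_\swarrow,L_\nearrow,R_\nwarrow,L_\searrow,R_\swarrow)$ is a matched pair of dendriform algebras, then $N_{\lambda_1,\lambda_2,\lambda_3,\lambda_4}$ is also a Nijenhuis operator on $A_v\bowtie_{L_\nearrow,R_\nwarrow,L_\searrow,R_\swarrow}^{L_\nearrow,R_\nwarrow,L_\searrow,R_\swarrow}A_v$; and in this case $$\theta((x,y)):=(y+x,x),\qquad x,y\in A,$$ is an isomorphism of dendriform algebras from $A_v\bowtie_{L_\nearrow,R_\nwarrow,L_\searrow,R_\swarrow}^{L_\nearrow,R_\nwarrow,L_\searrow,R_\swarrow}A_v$ to $A_v\ltimes_{L_\nearrow,R_\nwarrow,L_\searrow,R_\swarrow}A$.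
   Context: All vector spaces are finite-dimensional over a fixed field $\mathbb F$. A dendriform algebra $(D,\wedge,\vee)$ is a vector space with two bilinear operations such that, with $x\star y=x\wedge y+x\vee y$: $(x\wedge y)\wedge z=x\wedge(y\star z)$, $(x\vee y)\wedge z=x\vee(y\wedge z)$, $(x\star y)\vee z=x\vee(y\vee z)$. A quadri-algebra $(A,\nwarrow,\nearrow,\swarrow,\searrow)$ is a vector space with four bilinear operations; put $x\succ y=x\nearrow y+x\searrow y$, $x\prec y=x\nwarrow y+x\swarrow y$, $x\vee y=x\swarrow y+x\searrow y$, $x\wedge y=x\nwarrow y+x\nearrow y$, $x\star y=x\nwarrow y+x\nearrow y+x\swarrow y+x\searrow y$; the axioms are, for all $x,y,z$: $(x\nwarrow y)\nwarrow z=x\nwarrow(y\star z)$, $(x\nearrow y)\nwarrow z=x\nearrow(y\prec z)$, $(x\wedge y)\nearrow z=x\nearrow(y\succ z)$, $(x\swarrow y)\nwarrow z=x\swarrow(y\wedge z)$, $(x\searrow y)\nwarrow z=x\searrow(y\nwarrow z)$, $(x\vee y)\nearrow z=x\searrow(y\nearrow z)$, $(x\prec y)\swarrow z=x\swarrow(y\vee z)$, $(x\succ y)\swarrow z=x\searrow(y\swarrow z)$, $(x\star y)\searrow z=x\searrow(y\searrow z)$. Then $A_v:=(A,\wedge,\vee)$ is a dendriform algebra. $L_\circ(x)y=x\circ y=R_\circ(y)x$. $A_v\ltimes_{L_\nearrow,R_\nwarrow,L_\searrow,R_\swarrow}A$ is the (semidirect product) dendriform algebra on $A\oplus A$ with $(x_1,x_2)\wedge(y_1,y_2)=(x_1\wedge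 y_1,\ x_1\nearrow y_2+x_2\nwarrow y_1)$ and $(x_1,x_2)\vee(y_1,y_2)=(x_1\vee y_1,\ x_1\searrow y_2+x_2\swarrow y_1)$. The tuple $(A_v,A_v,L_\nearrow,R_\nwarrow,L_\searrow,R_\swarrow,L_\nearrow,R_\nwarrow,L_\searrow,R_\swarrow)$ is a matched pair of dendriform algebras if the operations $(x_1,x_2)\wedge(y_1,y_2)=(x_1\wedge y_1+x_2\nearrow y_1+x_1\nwarrow y_2,\ x_2\wedge y_2+x_1\nearrow y_2+x_2\nwarrow y_1)$ and $(x_1,x_2)\vee(y_1,y_2)=(x_1\vee y_1+x_2\searrow y_1+x_1\swarrow y_2,\ x_2\vee y_2+x_1\searrow y_2+x_2\swarrow y_1)$ define a dendriform algebra on $A\oplus A$; this dendriform algebra is then denoted $A_v\bowtie_{L_\nearrow,R_\nwarrow,L_\searrow,R_\swarrow}^{L_\nearrow,R_\nwarrow,L_\searrow,R_\swarrow}A_v$. A linear operator $N$ on a vector space with a set $\Omega$ of bilinear operations is a Nijenhuis operator if for each $\ast\in\Omega$ and all $u,v$: $N(u)\ast N(v)=N(N(u)\ast v+u\ast N(v)-N(u\ast v))$; here $\Omega=\{\wedge,\vee\}$. *)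

(* Defs.v *)
From mathcomp Require Import all_boot all_order all_algebra.

Set Implicit Arguments.
Unset Strict Implicit.
Unset Printing Implicit Defensive.

Import GRing.Theory.
Local Open Scope ring_scope.

Definition is_bilinear (F : fieldType) (U V W : vectType F)
    (op : U -> V -> W) : Prop :=
  bilinear_for *:%R *:%R op.

Lemma is_bilinearD (F : fieldType) (U V W : vectType F) (f g : U -> V -> W) :
  is_bilinear f -> is_bilinear g -> is_bilinear (fun x y => f x y + g x y).
Proof.
move=> [f1 f2] [g1 g2]; split=> z a x y /=.
  by rewrite [f _ z]f1 [g _ z]g1 scalerDr addrACA.
by rewrite f2 g2 scalerDr addrACA.
Qed.

Lemma is_bilinearDl (F : fieldType) (U V W : vectType F) (f : U -> V -> W) :
  is_bilinear f -> forall x y z, f (x + y) z = f x z + f y z.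
Proof.
by move=> [f1 _] x y z; have := f1 z 1 x y; rewrite /= !scale1r.
Qed.

Lemma is_bilinearDr (F : fieldType) (U V W : vectType F) (f : U -> V -> W) :
  is_bilinear f -> forall x y z, f x (y + z) = f x y + f x z.
Proof. by move=> [_ f2] x y z; have := f2 x 1 y z; rewrite /= !scale1r. Qed.

Record is_dendriform (F : fieldType) (V : vectType F)
    (wedge vee : V -> V -> V) : Prop := IsDendriform {
  wedge_bilinear : is_bilinear wedge;
  vee_bilinear : is_bilinear vee;
  wedge_wedge : forall x y z,
    wedge (wedge x y) z = wedge x (wedge y z + vee y z);
  vee_wedge : forall x y z, wedge (vee x y) z = vee x (wedge y z);
  star_vee : forall x y z, vee (wedge x y + vee x y) z = vee x (vee y z)
}.

Record dendriform (F : fieldType) (V : vectType F) : Type := Dendriform {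
  dwedge : V -> V -> V;
  dvee : V -> V -> V;
  dendriformP : is_dendriform dwedge dvee
}.

Definition nijenhuis (F : fieldType) (V : vectType F) (D : dendriform V)
    (N : V -> V) : Prop :=
  [/\ linear N,
      forall u v, dwedge D (N u) (N v)
        = N (dwedge D (N u) v + dwedge D u (N v) - N (dwedge D u v))
    & forall u v, dvee D (N u) (N v)
        = N (dvee D (N u) v + dvee D u (N v) - N (dvee D u v))].

Definition dendriform_iso (F : fieldType) (V W : vectType F)
    (D : dendriform V) (E : dendriform W) (f : V -> W) : Prop :=
  [/\ linear f, bijective f,
      forall u v, f (dwedge D u v) = dwedge E (f u) (f v)
    & forall u v, f (dvee D u v) = dvee E (f u) (f v)].

(** In [semi_op] and [matched_op], [l] and [r] are the left and right actions
    of the first summand on the second, and [l'], [r'] those of the second on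
    the first, with the acting element always as first argument. *)

Definition semi_op (F : fieldType) (V W : vectType F) (op : V -> V -> V)
    (l r : V -> W -> W) (x y : V * W) : V * W :=
  (op x.1 y.1, l x.1 y.2 + r y.1 x.2).

Definition matched_op (F : fieldType) (V W : vectType F)
    (opV : V -> V -> V) (opW : W -> W -> W)
    (l r : V -> W -> W) (l' r' : W -> V -> V) (x y : V * W) : V * W :=
  (opV x.1 y.1 + l' x.2 y.1 + r' y.2 x.1,
   opW x.2 y.2 + l x.1 y.2 + r y.1 x.2).

Definition matched_pair (F : fieldType) (V W : vectType F)
    (D : dendriform V) (E : dendriform W)
    (lwedge rwedge lvee rvee : V -> W -> W)
    (lwedge' rwedge' lvee' rvee' : W -> V -> V) : Prop :=
  is_dendriform
    (matched_op (dwedge D) (dwedge E) lwedge rwedge lwedge' rwedge')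
    (matched_op (dvee D) (dvee E) lvee rvee lvee' rvee').

Definition bowtie (F : fieldType) (V W : vectType F)
    (D : dendriform V) (E : dendriform W)
    (lwedge rwedge lvee rvee : V -> W -> W)
    (lwedge' rwedge' lvee' rvee' : W -> V -> V)
    (H : matched_pair D E lwedge rwedge lvee rvee
           lwedge' rwedge' lvee' rvee') : dendriform (V * W)%type :=
  Dendriform H.

(** [nw], [ne], [sw], [se] are the operations written with the arrows pointing
    north-west, north-east, south-west, south-east. *)

Record is_quadri (F : fieldType) (A : vectType F)
    (nw ne sw se : A -> A -> A) : Prop := IsQuadri {
  nw_bilinear : is_bilinear nw;
  ne_bilinear : is_bilinear ne;
  sw_bilinear : is_bilinear sw;
  se_bilinear : is_bilinear se;
  nw_nw : forall x y z,
    nw (nw x y) z = nw x (nw y z + ne y z + sw y z + se y z);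
  ne_nw : forall x y z, nw (ne x y) z = ne x (nw y z + sw y z);
  wedge_ne : forall x y z, ne (nw x y + ne x y) z = ne x (ne y z + se y z);
  sw_nw : forall x y z, nw (sw x y) z = sw x (nw y z + ne y z);
  se_nw : forall x y z, nw (se x y) z = se x (nw y z);
  vee_ne : forall x y z, ne (sw x y + se x y) z = se x (ne y z);
  prec_sw : forall x y z, sw (nw x y + sw x y) z = sw x (sw y z + se y z);
  succ_sw : forall x y z, sw (ne x y + se x y) z = se x (sw y z);
  star_se : forall x y z,
    se (nw x y + ne x y + sw x y + se x y) z = se x (se y z)
}.

Record quadri (F : fieldType) (A : vectType F) : Type := Quadri {
  qnw : A -> A -> A;
  qne : A -> A -> A;
  qsw : A -> A -> A;
  qse : A -> A -> A;
  quadriP : is_quadri qnw qne qsw qse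
}.

Definition Lop (T : Type) (op : T -> T -> T) (x y : T) : T := op x y.
Definition Rop (T : Type) (op : T -> T -> T) (y x : T) : T := op x y.

Section VerticalDendriform.
Variables (F : fieldType) (A : vectType F) (Q : quadri A).

Definition qwedge (x y : A) : A := qnw Q x y + qne Q x y.
Definition qvee (x y : A) : A := qsw Q x y + qse Q x y.

Lemma vertical_is_dendriform : is_dendriform qwedge qvee.
Proof.
have [bnw bne bsw bse q1 q2 q3 q4 q5 q6 q7 q8 q9] := quadriP Q.
have Dr := (is_bilinearDr bnw, is_bilinearDr bne, is_bilinearDr bsw,
            is_bilinearDr bse).
split; [exact: is_bilinearD | exact: is_bilinearD | | |] => x y z;
  rewrite /qwedge /qvee.
- rewrite q3 (is_bilinearDl bnw) q1 q2 !Dr !addrA.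
  by rewrite [X in X + _ = _]addrAC.
- by rewrite q6 (is_bilinearDl bnw) q4 q5 !Dr !addrA.
- rewrite [X in qse Q X z]addrA q9.
  by rewrite [X in qsw Q X z]addrACA (is_bilinearDl bsw) q7 q8 !Dr !addrA.
Qed.

Definition vertical : dendriform A := Dendriform vertical_is_dendriform.

Lemma semi_op_bilinear (op f g : A -> A -> A) :
  is_bilinear op -> is_bilinear f -> is_bilinear g ->
  is_bilinear (semi_op op (Lop f) (Rop g)).
Proof.
move=> [o1 o2] [f1 f2] [g1 g2]; split=> z a x y; apply: injective_projections.
- exact: (o1 z.1 a x.1 y.1).
- rewrite [LHS](congr2 +%R (f1 z.2 a x.1 y.1) (g1 z.1 a x.2 y.2)) /=.
  by rewrite scalerDr addrACA.
- exact: (o2 z.1 a x.1 y.1).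
rewrite [LHS](congr2 +%R (f2 z.1 a x.2 y.2) (g2 z.2 a x.1 y.1)) /=.
by rewrite scalerDr addrACA.
Qed.

Lemma vertical_semi_is_dendriform :
  is_dendriform
    (semi_op (dwedge vertical) (Lop (qne Q)) (Rop (qnw Q)))
    (semi_op (dvee vertical) (Lop (qse Q)) (Rop (qsw Q))).
Proof.
have [bw bv w1 w2 w3] := vertical_is_dendriform.
have [bnw bne bsw bse q1 q2 q3 q4 q5 q6 q7 q8 q9] := quadriP Q.
have Dr := (is_bilinearDr bnw, is_bilinearDr bne, is_bilinearDr bsw,
            is_bilinearDr bse).
split; [exact: semi_op_bilinear | exact: semi_op_bilinear | | |] => x y z;
  rewrite /semi_op /Lop /Rop; congr (_, _) => //=; rewrite /qwedge /qvee.
- rewrite q3 (is_bilinearDl bnw) q1 q2 !Dr !addrA.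
  by rewrite [X in X + _ + _ + _ + _ + _ = _]addrAC.
- by rewrite q6 (is_bilinearDl bnw) q4 q5 !Dr !addrA.
- rewrite [X in qse Q X z.2]addrA q9.
  by rewrite [X in qsw Q X z.1]addrACA (is_bilinearDl bsw) q7 q8 !Dr !addrA.
Qed.

Definition vertical_semi : dendriform (A * A)%type :=
  Dendriform vertical_semi_is_dendriform.

Definition vertical_matched_pair : Prop :=
  matched_pair vertical vertical
    (Lop (qne Q)) (Rop (qnw Q)) (Lop (qse Q)) (Rop (qsw Q))
    (Lop (qne Q)) (Rop (qnw Q)) (Lop (qse Q)) (Rop (qsw Q)).

Definition Nlambda (l1 l2 l3 l4 : F) (p : A * A) : A * A :=
  (l1 *: p.2 + l2 *: p.1, l3 *: p.1 + l4 *: p.2).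

Definition theta (p : A * A) : A * A := (p.2 + p.1, p.1).

End VerticalDendriform.

Arguments Nlambda {F A} l1 l2 l3 l4 p.
Arguments theta {F A} p.

(* Main.v *)
(** Write [f] for the operation with an east arrow and [g] for the one with a
    west arrow. On both dendriform algebras each of [wedge] and [vee] has the
    form [u * v = f (phi u) v + g u (phi v)], with [f] and [g] acting
    coordinatewise and [phi : A + A -> A] equal to the first projection on the
    semidirect product and to the sum of the two coordinates on the bowtie.
    A matrix operator [N] commutes with coordinatewise linear maps, so
    [N u * N v = N (f (phi (N u)) v + g u (phi (N v)))], while the two remaining
    terms of [N u * v + u * N v] add up to [N (u * v)]. Finally, [theta] is
    itself a matrix operator and carries the first [phi] to the second. *)

Require Import Defs.
From mathcomp Require Import all_boot all_order all_algebra.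

Set Implicit Arguments.
Unset Strict Implicit.
Unset Printing Implicit Defensive.

Import GRing.Theory.
Local Open Scope ring_scope.

Section TwistedProduct.
Variables (F : fieldType) (A : vectType F).

Definition coordwise (h : A -> A) (u : A * A) : A * A := (h u.1, h u.2).

Definition twisted_op (phi : A * A -> A) (f g : A -> A -> A)
    (u v : A * A) : A * A :=
  coordwise (f (phi u)) v + coordwise (g^~ (phi v)) u.

Lemma Nlambda_linear (l1 l2 l3 l4 : F) :
  linear (@Nlambda F A l1 l2 l3 l4).
Proof.
move=> a [x1 x2] [y1 y2]; apply: injective_projections => /=;
  rewrite !scalerDr !scalerA ![a * _]mulrC.
  by rewrite addrACA.
by rewrite addrACA.
Qed.

Lemma NlambdaD (l1 l2 l3 l4 : F) (u v : A * A) :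
  Nlambda l1 l2 l3 l4 (u + v) = Nlambda l1 l2 l3 l4 u + Nlambda l1 l2 l3 l4 v.
Proof. by have := Nlambda_linear l1 l2 l3 l4 1 u v; rewrite !scale1r. Qed.

Lemma Nlambda_coordwise (l1 l2 l3 l4 : F) (h : A -> A) (u : A * A) :
  linear h ->
  Nlambda l1 l2 l3 l4 (coordwise h u) = coordwise h (Nlambda l1 l2 l3 l4 u).
Proof.
move=> hL.
have hD x y : h (x + y) = h x + h y.
  by have := hL 1 x y; rewrite !scale1r.
have h0 : h 0 = 0 by apply: (addrI (h 0)); rewrite -hD !addr0.
have hZ a x : h (a *: x) = a *: h x.
  by have := hL a x 0; rewrite h0 !addr0.
by rewrite /coordwise /Nlambda /= !hD !hZ.
Qed.

(** Once [phi u] and [phi v] are frozen, both summands are coordinatewise linear images, so the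
    operator passes to [v] and [u] without touching [phi]. *)
Lemma Nlambda_twisted (l1 l2 l3 l4 : F) (phi : A * A -> A) (f g : A -> A -> A)
    (u v : A * A) :
  is_bilinear f -> is_bilinear g ->
  Nlambda l1 l2 l3 l4 (twisted_op phi f g u v)
    = coordwise (f (phi u)) (Nlambda l1 l2 l3 l4 v)
      + coordwise (g^~ (phi v)) (Nlambda l1 l2 l3 l4 u).
Proof.
move=> [_ fr] [gl _]; rewrite NlambdaD.
by rewrite (Nlambda_coordwise _ _ _ _ _ (fr _))
  (Nlambda_coordwise _ _ _ _ _ (gl _)).
Qed.

Lemma twisted_nijenhuis (l1 l2 l3 l4 : F) (phi : A * A -> A)
    (f g : A -> A -> A) (u v : A * A) (N := Nlambda l1 l2 l3 l4) :
  is_bilinear f -> is_bilinear g ->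
  twisted_op phi f g (N u) (N v)
    = N (twisted_op phi f g (N u) v + twisted_op phi f g u (N v)
         - N (twisted_op phi f g u v)).
Proof.
move=> bf bg; rewrite [N (twisted_op _ _ _ u v)]Nlambda_twisted // -/N.
(* The terms with [N] outside [phi] cancel; those with [phi (N u)] or [phi (N v)] survive. *)
have -> : twisted_op phi f g (N u) v + twisted_op phi f g u (N v)
    - (coordwise (f (phi u)) (N v) + coordwise (g^~ (phi v)) (N u))
  = coordwise (f (phi (N u))) v + coordwise (g^~ (phi (N v))) u.
  rewrite /twisted_op [coordwise (f (phi u)) _ + _ in X in X - _]addrC.
  by rewrite addrACA [X in _ - X]addrC addrK.
have [[_ fr] [gl _]] := (bf, bg).
by rewrite [RHS]NlambdaD (Nlambda_coordwise _ _ _ _ _ (fr _))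
  (Nlambda_coordwise _ _ _ _ _ (gl _)).
Qed.

Lemma semi_op_twisted (op f g : A -> A -> A) :
  (forall x y, op x y = g x y + f x y) ->
  semi_op op (Lop f) (Rop g) =2 twisted_op fst f g.
Proof.
by move=> opE u v; apply: injective_projections; rewrite //= opE addrC.
Qed.

(** In each coordinate the two halves of [op] join the cross actions: additivity of [f] on the left
    and of [g] on the right merges the acting elements into [u.2 + u.1] and [v.2 + v.1]. *)
Lemma matched_op_twisted (op f g : A -> A -> A) :
  is_bilinear f -> is_bilinear g ->
  (forall x y, op x y = g x y + f x y) ->
  matched_op op op (Lop f) (Rop g) (Lop f) (Rop g)
    =2 twisted_op (fun u => u.2 + u.1) f g.
Proof.
move=> bf bg opE [a b] [c d]; apply: injective_projections;
  rewrite /matched_op /= opE /Lop /Rop (is_bilinearDl bf) (is_bilinearDr bg);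
  rewrite -[X in X + _]addrA addrAC addrC.
  by rewrite [f a c + _]addrC [g a c + _]addrC.
by rewrite [g b d + _]addrC.
Qed.

(** This lets [theta] inherit linearity and [Nlambda_twisted]. *)
Lemma theta_Nlambda : @theta F A =1 Nlambda 1 1 1 0.
Proof. by move=> u; rewrite /theta /Nlambda !scale1r scale0r addr0. Qed.

Lemma theta_bij : bijective (@theta F A).
Proof.
exists (fun u : A * A => (u.2, u.1 - u.2)) => -[x y]; rewrite /theta /=.
  by rewrite addrK.
by rewrite subrK.
Qed.

(** Since [(theta u).1] computes to [u.2 + u.1], [Nlambda_twisted] already yields the product over
    [fst]. *)
Lemma theta_twisted (f g : A -> A -> A) (u v : A * A) :
  is_bilinear f -> is_bilinear g ->
  theta (twisted_op (fun u => u.2 + u.1) f g u v)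
    = twisted_op fst f g (theta u) (theta v).
Proof.
by move=> bf bg; rewrite theta_Nlambda Nlambda_twisted // -!theta_Nlambda.
Qed.

End TwistedProduct.

Theorem proposition8p6 (F : fieldType) (A : vectType F) (Q : quadri A)
    (l1 l2 l3 l4 : F) :
  nijenhuis (vertical_semi Q) (Nlambda l1 l2 l3 l4) /\
  (forall H : vertical_matched_pair Q,
     nijenhuis (bowtie H) (Nlambda l1 l2 l3 l4) /\
     dendriform_iso (bowtie H) (vertical_semi Q) theta).
Proof.
have [bnw bne bsw bse _ _ _ _ _ _ _ _ _] := quadriP Q.
(* The required splitting of [op] is the definition of [qwedge], and below of [qvee]. *)
have sw : dwedge (vertical_semi Q) =2 twisted_op fst (qne Q) (qnw Q).
  exact: semi_op_twisted.
have sv : dvee (vertical_semi Q) =2 twisted_op fst (qse Q) (qsw Q).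
  exact: semi_op_twisted.
split=> [|H].
  split=> [|u v|u v]; first exact: Nlambda_linear.
    by rewrite !sw; exact: twisted_nijenhuis.
  by rewrite !sv; exact: twisted_nijenhuis.
have mw : dwedge (bowtie H)
    =2 twisted_op (fun u => u.2 + u.1) (qne Q) (qnw Q).
  exact: matched_op_twisted.
have mv : dvee (bowtie H) =2 twisted_op (fun u => u.2 + u.1) (qse Q) (qsw Q).
  exact: matched_op_twisted.
split; split.
- exact: Nlambda_linear.
- by move=> u v; rewrite !mw; exact: twisted_nijenhuis.
- by move=> u v; rewrite !mv; exact: twisted_nijenhuis.
- by move=> a u v; rewrite !theta_Nlambda; exact: Nlambda_linear.
- exact: theta_bij.
- by move=> u v; rewrite mw sw; exact: theta_twisted.
- by move=> u v; rewrite mv sv; exact: theta_twisted.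
Qed.
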